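(* Let $C,D\subseteq\mathbb{R}^n$ be convex sets and let $T_a:=T_a(C,D)$ be their affine joint supporting subspace. Then $C\cap T_a$ and $D\cap T_a$ are not separated in $T_a$.
   Context: Separation: given an affine subspace $V\subseteq\mathbb{R}^n$ (possibly empty), two convex sets $C,D\subseteq V$ are said to be separated in $V$ when there exists $u\in(V-V)\setminus\{0\}$ such that $\langle u,c\rangle\le\langle u,d\rangle$ for all $c\in C$, $d\in D$. Here $A\pm B=\{a\pm b\mid a\in A,b\in B\}$. Faces: a subset $F\subseteq C$ of a convex set $C\subseteq\mathbb{R}^n$ is a face of $C$ if for all $y,z\in C$, whenever the open segment $]y,z[ = [y,z]\setminus\{y,z\}$ meets $F$, both $y,z\in F$. For $S\subseteq C$, $F_C(S)$ denotes the smallest face of $C$ containing $S$; $F_C(x)=F_C(\{x\})$. Joint supporting subspace: for convex $C,D\subseteq\mathbb{R}^n$ with $C\cap D\neq\emptyset$, $T(C,D):=\operatorname{Span} F_{C-D}(0)$ (linear span) and $T_a(C,D):=T(C,D)+(C\cap D)$. If $C\cap D=\emptyset$, then $T_a(C,D)=\emptyset$. *)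

(* Defs.v *)
From mathcomp Require Import all_boot all_order all_algebra.
From mathcomp Require Import interval_inference boolp classical_sets.
From mathcomp Require Import reals convex.

Set Implicit Arguments.
Unset Strict Implicit.
Unset Printing Implicit Defensive.

Import Order.TTheory GRing.Theory Num.Theory.

Local Open Scope classical_set_scope.
Local Open Scope ring_scope.
Local Open Scope convex_scope.

Definition dot (R : realType) (n : nat) (u v : 'rV[R]_n) : R :=
  \sum_(i < n) u 0 i * v 0 i.

Section Lmodule.
Variables (R : realType) (E : lmodType R).
Implicit Types A B C D F S W : set E.

Definition minkowski_add A B : set E := [set a + b | a in A & b in B].

Definition minkowski_sub A B : set E := [set a - b | a in A & b in B].

(* The linear span; [W] is turned into a boolean predicate because
   [submod_closed] is stated for those. *)
Definition lspan A : set E :=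
  smallest (fun W => GRing.submod_closed [in W]) A.

Definition segment (y z : E) : set E :=
  [set (y : convex_lmodType E) <| t |> z | t in [set: {i01 R}]].

(* Empty when y = z. *)
Definition open_segment (y z : E) : set E := segment y z `\` [set y; z].

(* A face is not required to be convex or nonempty. *)
Definition is_face C F : Prop :=
  F `<=` C /\
  forall y z, C y -> C z -> open_segment y z `&` F !=set0 -> F y /\ F z.

(* Faces are stable under intersection and C is a face of itself, so this is
   the smallest face of C containing S as soon as S `<=` C. *)
Definition face_hull C S : set E := smallest (is_face C) S.

(* Meaningful only when C and D meet, i.e. when 0 lies in C - D. *)
Definition joint_support C D : set E :=
  lspan (face_hull (minkowski_sub C D) [set 0]).

(* When C and D are disjoint, this is empty, as a sum with the empty set. *)
Definition joint_affine_support C D : set E :=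
  minkowski_add (joint_support C D) (C `&` D).

End Lmodule.

(* To be used for an affine subspace V (possibly empty) and convex sets
   C, D `<=` V; V - V is then the direction of V, or empty. *)
Definition separated_in (R : realType) (n : nat) (V C D : set 'rV[R]_n) : Prop :=
  exists2 u, (minkowski_sub V V `\` [set 0]) u &
    forall c d, C c -> D d -> dot u c <= dot u d.

(* Main.v *)
Require Import Defs.
From mathcomp Require Import all_boot all_order all_algebra.
From mathcomp Require Import interval_inference boolp classical_sets.
From mathcomp Require Import reals convex.
From mathcomp Require Import ring lra.

Set Implicit Arguments.
Unset Strict Implicit.
Unset Printing Implicit Defensive.

Import Order.TTheory GRing.Theory Num.Theory.

Local Open Scope classical_set_scope.
Local Open Scope ring_scope.

(** Write [E] for [C - D], so that the joint supporting subspace [T] is the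
    span of the smallest face of [E] containing [0].

    For a convex set [E] containing [0], that face consists of the points [x]
    of [E] from which one can walk through [0] and still be in [E]: some
    [t *: x + (1 - t) *: x'] with [x'] in [E] and [0 < t < 1] vanishes
    ([face_hull0E]). Suppose that [x = c - d] and [x' = c' - d'] are
    such a pair. Then [q = t *: c + (1 - t) *: c' = t *: d + (1 - t) *: d'] lies
    in both [C] and [D], and the same weights [t] and [1 - t] balance [c - q]
    against [c' - q], and [q - d] against [q - d'], in [E]. Hence [c - q] and
    [q - d] belong to the face too, so [c] and [d] both lie in [T + q], inside
    [Ta] ([balanced_meet], [balanced_joint]).

    Now let [u] separate [C] and [D] in [Ta]. By the preceding remark
    [dot u x <= 0] for every [x] in the face; applied to both members of a
    balanced pair, this forces [dot u x = 0]. So [u] is orthogonal to the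
    face, hence to its span [T]. But the direction of [Ta] is contained in [T],
    because differences of points of [C `&` D] belong to the face; therefore
    [u] is orthogonal to itself and [u = 0]. *)

(** * Convex combinations and open segments *)

Section Convexity.
Variables (R : realType) (E : lmodType R).
Implicit Types (A C D F : set E) (t : R).

Lemma convex_setD A t y z : convex_set A -> 0 <= t -> t <= 1 ->
  A y -> A z -> A (t *: y + (1 - t) *: z).
Proof.
move=> cA t0 t1 /mem_set Ay /mem_set Az.
exact/set_mem/(cA y z (Itv01 t0 t1) Ay Az).
Qed.

Lemma convex_setZD A a b y z : convex_set A -> 0 < a -> 0 < b ->
  A y -> A z -> exists2 v, A v & a *: y + b *: z = (a + b) *: v.
Proof.
move=> cA a0 b0 Ay Az.
have ab0 : 0 < a + b by rewrite addr_gt0.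
have abN0 : a + b != 0 by rewrite gt_eqF.
exists ((a / (a + b)) *: y + (1 - a / (a + b)) *: z).
  apply: convex_setD => //; first by rewrite divr_ge0 // ltW.
  by rewrite ler_pdivrMr // mul1r lerDl ltW.
rewrite scalerDr !scalerA; congr (_ *: _ + _ *: _); by field.
Qed.

Lemma convex_minkowski_sub C D :
  convex_set C -> convex_set D -> convex_set (minkowski_sub C D).
Proof.
move=> cC cD x y t /set_mem[c Cc [d Dd <-]] /set_mem[c' Cc' [d' Dd' <-]].
have t0 : 0 <= t%:num by [].
have t1 : t%:num <= 1 by [].
apply/mem_set; exists (t%:num *: c + (1 - t%:num) *: c').
  exact: convex_setD.
exists (t%:num *: d + (1 - t%:num) *: d'); first exact: convex_setD.
by rewrite opprD addrACA -!scalerBr.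
Qed.

Lemma open_segmentP (y z w : E) : open_segment y z w ->
  exists2 t, 0 < t < 1 & w = t *: y + (1 - t) *: z.
Proof.
case=> -[t _ <-] /not_orP[/eqP ny /eqP nz].
exists t%:num => //; rewrite !lt_neqAle ge0 le1 !andbT.
apply/andP; split.
- apply: contra nz => /eqP t0; apply/eqP.
  by rewrite /conv/= /unstable.onem -t0 scale0r add0r subr0 scale1r.
- apply: contra ny => /eqP t1; apply/eqP.
  by rewrite /conv/= /unstable.onem t1 subrr scale0r scale1r addr0.
Qed.

Lemma open_segment_conv (y z : E) t : y <> z -> 0 < t < 1 ->
  open_segment y z (t *: y + (1 - t) *: z).
Proof.
move=> /eqP yz /andP[t0 t1]; split; first by exists (Itv01 (ltW t0) (ltW t1)).
have yE : t *: y + (1 - t) *: z - y = (1 - t) *: (z - y).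
  rewrite addrAC -[X in _ - X]scale1r -scalerBl -(opprB 1 t) scaleNr addrC.
  by rewrite -scalerBr.
have zE : t *: y + (1 - t) *: z - z = t *: (y - z).
  rewrite -addrA -[X in _ - X]scale1r -scalerBl addrAC subrr add0r scaleNr.
  by rewrite -scalerBr.
case=> /eqP; rewrite -subr_eq0.
- rewrite yE scaler_eq0 !subr_eq0 (gt_eqF t1) => /eqP zy.
  by rewrite zy eqxx in yz.
- by rewrite zE scaler_eq0 (gt_eqF t0) subr_eq0 (negbTE yz).
Qed.

End Convexity.

(** * The smallest face containing the origin *)

Section Balanced.
Variables (R : realType) (E : lmodType R).
Implicit Types (A C D F : set E).

(** Weights summing to [1], rather than the equivalent condition that [A]
    contains a negative multiple of [x], make the relation symmetric in [x] and
    [x'] up to exchanging the weights. *)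
Definition balanced A : set E := [set x | A x /\
  exists t x', [/\ 0 < t < 1, A x' & t *: x + (1 - t) *: x' = 0]].

Lemma balanced_pair A x x' t : 0 < t < 1 -> A x -> A x' ->
  t *: x + (1 - t) *: x' = 0 -> balanced A x /\ balanced A x'.
Proof.
move=> /andP[t0 t1] Ax Ax' e; split; split=> //.
  by exists t, x'; rewrite t0 t1.
exists (1 - t), x; rewrite subr_gt0 t1 gtrBl t0; split=> //.
by rewrite subKr addrC.
Qed.

(** If [w] is balanced by [w'] and lies between [y] and [z], then [y] is
    balanced by a suitable mixture of [z] and [w']. *)
Lemma balanced_left A y z w s : convex_set A -> A y -> A z ->
  0 < s < 1 -> w = s *: y + (1 - s) *: z -> balanced A w -> balanced A y.
Proof.
move=> cA Ay Az /andP[s0 s1] -> [_ [t [w' [/andP[t0 t1] Aw' e]]]].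
split=> //.
have a0 : 0 < t * (1 - s) by rewrite mulr_gt0 ?subr_gt0.
have b0 : 0 < 1 - t by rewrite subr_gt0.
have [v Av vE] := convex_setZD cA a0 b0 Az Aw'.
exists (t * s), v; split=> //.
  by rewrite mulr_gt0 // -subr_gt0; nra.
rewrite -e scalerDr !scalerA -addrA vE; congr (_ + _ *: _); ring.
Qed.

Lemma is_face_balanced A : convex_set A -> is_face A (balanced A).
Proof.
move=> cA; split=> [x []//|y z Ay Az [w [/open_segmentP[s s01 wE] bw]]].
split; first exact: (balanced_left cA Ay Az s01 wE).
have [s0 s1] := andP s01.
apply: (@balanced_left A z y w (1 - s)) => //.
  by rewrite subr_gt0 s1 gtrBl.
by rewrite subKr addrC.
Qed.

Lemma balanced0 A : A 0 -> balanced A 0.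
Proof.
move=> A0; split=> //; exists (2^-1), 0; split=> //; last first.
  by rewrite !scaler0 addr0.
by apply/andP; split; lra.
Qed.

Lemma balanced_sub_face A F : is_face A F -> F 0 -> balanced A `<=` F.
Proof.
move=> [_ fF] F0 x [Ax [t [x' [t01 Ax' e]]]].
have [xx'|/eqP xx'] := eqVneq x x'.
  by move: e; rewrite -xx' -scalerDl addrC subrK scale1r => ->.
apply: proj1 (fF x x' Ax Ax' _); exists 0; split=> //.
by rewrite -e; exact: open_segment_conv.
Qed.

Lemma face_hull0E A : convex_set A -> A 0 -> face_hull A [set 0] = balanced A.
Proof.
move=> cA A0; apply/seteqP; split.
  by apply: smallest_sub => [|_ ->]; [exact: is_face_balanced|exact: balanced0].
by move=> x bx F [fF F0]; apply: (balanced_sub_face fF) => //; exact: F0.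
Qed.

(** The key point: a balanced difference [c - d] splits, through a common point
    [q] of [C] and [D], into two balanced differences. *)
Lemma balanced_meet C D x : convex_set C -> convex_set D ->
  balanced (minkowski_sub C D) x ->
  exists c d, [/\ C c, D d, x = c - d &
    exists2 q, (C `&` D) q & balanced (minkowski_sub C D) (c - q) /\
                             balanced (minkowski_sub C D) (q - d)].
Proof.
move=> cC cD [[c Cc [d Dd <-]] [t [_ [t01 [c' Cc' [d' Dd' <-]] e]]]].
have /andP[t0 t1] := t01.
set q := t *: c + (1 - t) *: c'.
have qE : q = t *: d + (1 - t) *: d'.
  by apply/eqP; rewrite -subr_eq0 -e !scalerBr opprD addrACA.
have Cq : C q by apply: convex_setD => //; exact: ltW.
have Dq : D q by rewrite qE; apply: convex_setD => //; exact: ltW.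
have qt : t *: q + (1 - t) *: q = q by rewrite -scalerDl addrC subrK scale1r.
exists c, d; split=> //; exists q => //; split.
- apply: proj1 (balanced_pair (x' := c' - q) t01 _ _ _).
  + by exists c => //; exists q.
  + by exists c' => //; exists q.
  + by rewrite !scalerBr addrACA -opprD qt subrr.
- apply: proj1 (balanced_pair (x' := q - d') t01 _ _ _).
  + by exists q => //; exists d.
  + by exists q => //; exists d'.
  + by rewrite !scalerBr addrACA -opprD qt -qE subrr.
Qed.

Lemma balanced_meet_sub C D p q : (C `&` D) p -> (C `&` D) q ->
  balanced (minkowski_sub C D) (p - q).
Proof.
move=> [Cp Dp] [Cq Dq]; split; first by exists p => //; exists q.
exists 2^-1, (q - p); split.
- by apply/andP; split; lra.
- by exists q => //; exists p.
- have -> : 1 - 2^-1 = 2^-1 :> R by field.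
  by rewrite -scalerDr addrA subrK subrr scaler0.
Qed.

End Balanced.

(** * The joint supporting subspace *)

Section JointSupport.
Variables (R : realType) (E : lmodType R).
Implicit Types (A C D W : set E).

Lemma lspanD A x y : lspan A x -> lspan A y -> lspan A (x + y).
Proof.
move=> Ax Ay W WA; have [[_ lW] _] := WA.
rewrite -[x]scale1r; apply/set_mem/lW; apply/mem_set; first exact: Ax.
exact: Ay.
Qed.

Lemma lspanN A x : lspan A x -> lspan A (- x).
Proof.
move=> Ax W WA; have [[W0 lW] _] := WA.
rewrite -scaleN1r -[_ *: x]addr0; apply/set_mem/lW => //.
by apply/mem_set; exact: Ax.
Qed.

Lemma joint_supportE C D : convex_set C -> convex_set D -> C `&` D !=set0 ->
  joint_support C D = lspan (balanced (minkowski_sub C D)).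
Proof.
move=> cC cD [p [Cp Dp]]; rewrite /joint_support face_hull0E //.
  exact: convex_minkowski_sub.
by exists p => //; exists p => //; rewrite subrr.
Qed.

(** This is how separation in [Ta] reaches the face: the [c] and [d] coming from
    [balanced_meet] are translates, by vectors of [T], of one point of
    [C `&` D]. *)
Lemma balanced_joint C D x : convex_set C -> convex_set D ->
  balanced (minkowski_sub C D) x ->
  exists c d, [/\ C c, D d, joint_affine_support C D c,
                  joint_affine_support C D d & x = c - d].
Proof.
move=> cC cD /(balanced_meet cC cD)[c [d [Cc Dd -> [q CDq [bc bd]]]]].
have jE := joint_supportE cC cD (ex_intro _ q CDq).
exists c, d; split=> //; rewrite /joint_affine_support jE.
- by exists (c - q); [exact: sub_gen_smallest|exists q => //; rewrite subrK].
- exists (d - q); last by exists q => //; rewrite subrK.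
  by rewrite -opprB; apply: lspanN; exact: sub_gen_smallest.
Qed.

Lemma joint_affine_support_direction C D u : convex_set C -> convex_set D ->
  let Ta := joint_affine_support C D in
  minkowski_sub Ta Ta u -> lspan (balanced (minkowski_sub C D)) u.
Proof.
move=> cC cD Ta [_ [s sT [p CDp <-]] [_ [s' s'T [p' CDp' <-]] <-]].
move: sT s'T; rewrite (joint_supportE cC cD (ex_intro _ p CDp)) => sT s'T.
rewrite opprD addrACA; apply: lspanD.
  by apply: lspanD => //; exact: lspanN.
by apply: sub_gen_smallest; exact: balanced_meet_sub.
Qed.

End JointSupport.

(** * The scalar product *)

Section Dot.
Variables (R : realType) (n : nat).
Implicit Types (u v : 'rV[R]_n) (A : set 'rV[R]_n).

Lemma dotDr u v w : dot u (v + w) = dot u v + dot u w.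
Proof. by rewrite /dot -big_split; apply: eq_bigr => i _; rewrite mxE mulrDr. Qed.

Lemma dotZr u a v : dot u (a *: v) = a * dot u v.
Proof. by rewrite /dot mulr_sumr; apply: eq_bigr => i _; rewrite mxE mulrCA. Qed.

Lemma dotBr u v w : dot u (v - w) = dot u v - dot u w.
Proof. by rewrite dotDr -scaleN1r dotZr mulN1r. Qed.

Lemma dot0r u : dot u 0 = 0.
Proof. by rewrite -(scale0r 0) dotZr mul0r. Qed.

Lemma dot_eq0 u : dot u u = 0 -> u = 0.
Proof.
move=> /eqP; rewrite psumr_eq0 => [/allP u0|i _]; last by rewrite -expr2 sqr_ge0.
apply/rowP => i; rewrite mxE; apply/eqP.
by have := u0 i (mem_index_enum i); rewrite mulf_eq0 orbb.
Qed.

Lemma lspan_orthogonal u A :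
  A `<=` [set x | dot u x = 0] -> lspan A `<=` [set x | dot u x = 0].
Proof.
move=> Au; apply: smallest_sub => //; split=> [|a x y]; rewrite !inE /=.
  exact: dot0r.
by move=> ux uy; rewrite dotDr dotZr ux uy mulr0 addr0.
Qed.

(** A linear form of constant sign takes values of opposite signs at the two
    ends of a balanced pair, unless it vanishes there. *)
Lemma balanced_orthogonal u A : (forall x, balanced A x -> dot u x <= 0) ->
  balanced A `<=` [set x | dot u x = 0].
Proof.
move=> uA x bx /=; have [Ax [t [x' [t01 Ax' e]]]] := bx.
have ux := uA _ bx.
have ux' := uA _ (proj2 (balanced_pair t01 Ax Ax' e)).
have /andP[t0 t1] := t01.
have := dot0r u; rewrite -e dotDr !dotZr => e0.
apply/eqP; rewrite eq_le ux /= -(pmulr_rge0 _ t0).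
have -> : t * dot u x = - ((1 - t) * dot u x') by apply/eqP; rewrite -addr_eq0 e0.
by rewrite oppr_ge0 mulr_ge0_le0 // subr_ge0 ltW.
Qed.

End Dot.

Theorem theorem4p2 (R : realType) (n : nat) (C D : set 'rV[R]_n) :
  convex_set C -> convex_set D ->
  let Ta := joint_affine_support C D in
  ~ separated_in Ta (C `&` Ta) (D `&` Ta).
Proof.
move=> cC cD Ta [u [uTa u0] sep]; apply: u0; apply: dot_eq0.
apply: (lspan_orthogonal _ (joint_affine_support_direction cC cD uTa)).
apply: balanced_orthogonal => x /(balanced_joint cC cD)[c [d [Cc Dd Tc Td ->]]].
by rewrite dotBr subr_le0; exact: sep.
Qed.
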